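(* Let $F$ be a heavy-tailed distribution on $[0,\infty)$. If for some $c\in(0,\infty)$ $$\int_0^x\overline{F}(x-y)\overline{F}(y)\,dy\sim c\,\overline{F}(x)\quad\text{as }x\to\infty,$$ then $F$ has a finite mean $a$ and $F\in\mathcal S^*$, i.e. $\int_0^x\overline{F}(x-y)\overline{F}(y)\,dy\sim 2a\overline{F}(x)$ as $x\to\infty$.
   Context: $\overline{F}(x)=F(x,\infty)$, assumed positive for all $x$. $F$ is heavy-tailed if $\int_0^\infty e^{\gamma x}F(dx)=\infty$ for every $\gamma>0$. A distribution $F$ on $[0,\infty)$ with finite mean $a$ belongs to the class $\mathcal S^*$ if $\int_0^x\overline{F}(x-y)\overline{F}(y)\,dy\sim 2a\overline{F}(x)$ as $x\to\infty$. *)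

(* Defs.v *)
From HB Require Import structures.
From mathcomp Require Import all_boot all_order all_algebra.
From mathcomp Require Import all_classical all_reals all_analysis.
Set Implicit Arguments. Unset Strict Implicit. Unset Printing Implicit Defensive.
Import Order.TTheory GRing.Theory Num.Theory.
Import numFieldNormedType.Exports.
Local Open Scope classical_set_scope.
Local Open Scope ring_scope.

Definition tail (R : realType) (P : probability R R) (x : R) : R :=
  fine (P `]x, +oo[%classic).

Definition supported_nonneg (R : realType) (P : probability R R) : Prop :=
  P `[0, +oo[%classic = 1%E.

Definition heavy_tailed (R : realType) (P : probability R R) : Prop :=
  forall gamma : R, 0 < gamma -> (\int[P]_x (expR (gamma * x))%:E = +oo)%E.

Definition mean (R : realType) (P : probability R R) : \bar R :=
  (\int[P]_x x%:E)%E.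

Definition tail_conv (R : realType) (P : probability R R) (x : R) : R :=
  Rintegral lebesgue_measure `[0, x]%classic (fun y => tail P (x - y) * tail P y).

(* Main.v *)
(** Write g for the tail of F, extended by 0 to the negative half-line, and a for
    its integral, which is the mean of F by Tonelli. Splitting the convolution at
    M and x - M gives [g * g (x) >= 2 g(x) \int_0^M g] for x >= 2M, so c >= 2a; in
    particular a is finite.

    Suppose c > 2a, say [g * g >= (2a + delta) g] beyond x0. For gamma, N > 0 put
    t(x) = min(x, N). As t is subadditive, integrating g * g against t e^(gamma t)
    gives at most 2 K p, where [K = \int t e^(gamma t) g] and
    [p = \int e^(gamma t) g], whence (2a + delta) K <= 2 K p + const. Heavy-tailedness
    makes p unbounded in N for every gamma > 0, so N can be chosen with p just above
    a + delta / 8 and at most a + delta / 4, which bounds K uniformly in gamma. But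
    p <= a + gamma K forces K >= delta / (8 gamma), absurd for small gamma. *)
Require Import Defs.
From HB Require Import structures.
From mathcomp Require Import all_boot all_order all_algebra.
From mathcomp Require Import all_classical all_reals all_analysis.
From mathcomp Require Import measurable_realfun ring lra.
Set Implicit Arguments.
Unset Strict Implicit.
Unset Printing Implicit Defensive.
Import Order.TTheory GRing.Theory Num.Theory.
Import numFieldNormedType.Exports.
Local Open Scope classical_set_scope.
Local Open Scope ring_scope.

(** * Translations and reflections of Lebesgue measure, and weighted convolutions *)

Section lebesgue_isometries.
Context {R : realType}.
Local Notation mu := (@lebesgue_measure R).
Local Open Scope ereal_scope.

(** Lebesgue measure is determined by its values on half-open intervals, and translation preserves
    their lengths. *)
Lemma lebesgue_measureD (a : R) (A : set R) : measurable A ->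
  pushforward mu ((fun x => x + a)%R : _ -> measurableTypeR R) A = mu A.
Proof.
have ms : measurable_fun setT ((fun x => x + a)%R : measurableTypeR R -> measurableTypeR R).
  exact: measurable_funD.
move=> mA; apply/esym.
pose m := isMeasurableFun.Build _ _ _ _ _ ms.
pose m' : {mfun _ >-> _} := HB.pack ((fun x => x + a)%R : measurableTypeR R -> measurableTypeR R) m.
apply: (@lebesgue_measure_unique R (pushforward mu m')) => //= _ [[u v]] _ <-.
rewrite /pushforward.
have -> : (fun x : R => (x + a)%R) @^-1` `]u, v] = `](u - a)%R, (v - a)%R]%classic.
  by apply/seteqP; split => x /=; rewrite !in_itv/= ltrBlDr lerBrDr.
rewrite !lebesgue_measure_itv/= !lte_fin ltrD2r.
by case: ifP => //; rewrite -!EFinD => _; congr EFin; ring.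
Qed.

Lemma ge0_integral_shift (f : R -> \bar R) (a : R) :
  measurable_fun [set: R] f -> (forall x, 0 <= f x) ->
  \int[mu]_x f (x + a)%R = \int[mu]_x f x.
Proof.
move=> mf f0.
have ms : measurable_fun setT ((fun x => x + a)%R : measurableTypeR R -> measurableTypeR R).
  exact: measurable_funD.
rewrite -(@ge0_integral_pushforward _ _ _ _ _ _ ms mu setT f)//.
by apply: eq_measure_integral => A mA _; exact: lebesgue_measureD.
Qed.

Lemma ge0_integral_opp (f : R -> \bar R) :
  measurable_fun [set: R] f -> (forall x, 0 <= f x) ->
  \int[mu]_x f (- x)%R = \int[mu]_x f x.
Proof.
move=> mf f0.
have ms : measurable_fun setT (-%R : measurableTypeR R -> measurableTypeR R) by [].
rewrite -(@ge0_integral_pushforward _ _ _ _ _ _ ms mu setT f)//.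
by apply: eq_measure_integral => A mA _; exact: lebesgue_measureN.
Qed.

Lemma ge0_integral_reflect (f : R -> \bar R) (a : R) :
  measurable_fun [set: R] f -> (forall x, 0 <= f x) ->
  \int[mu]_x f (a - x)%R = \int[mu]_x f x.
Proof.
move=> mf f0; rewrite -(ge0_integral_shift a mf f0).
rewrite -(@ge0_integral_opp (fun x => f (x + a)%R))//.
  by apply: eq_integral => x _; rewrite addrC.
by apply: (measurableT_comp mf); exact: measurable_funD.
Qed.

(** Tonelli exchanges the two integrals; then [x = z + y] is substituted in the inner one, for fixed
    [y]. The weight is thereby evaluated at a sum, where subadditivity can act. *)
Lemma ge0_integral_convolution (W f h : R -> R) :
  measurable_fun [set: R] W -> measurable_fun [set: R] f ->
  measurable_fun [set: R] h ->
  (forall x, 0 <= W x)%R -> (forall x, 0 <= f x)%R -> (forall x, 0 <= h x)%R ->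
  \int[mu]_x ((W x)%:E * \int[mu]_y (f (x - y) * h y)%:E) =
  \int[mu]_y \int[mu]_z (W (z + y) * f z * h y)%:E.
Proof.
move=> mW mf mh W0 f0 h0.
pose GR := measurableTypeR R.
have mk : measurable_fun [set: GR * GR]
    (fun p : GR * GR => (W p.1 * (f (p.1 - p.2) * h p.2))%:E).
  apply/measurable_EFinP; apply: measurable_funM.
    exact: (measurableT_comp mW).
  apply: measurable_funM; last exact: (measurableT_comp mh).
  by apply: (measurableT_comp mf); exact: measurable_funB.
transitivity (\int[mu]_x \int[mu]_y (W x * (f (x - y) * h y))%:E).
  apply: eq_integral => x _; rewrite -ge0_integralZl ?lee_fin//.
    apply/measurable_EFinP; apply: measurable_funM => //.
    by apply: (measurableT_comp mf); exact: measurable_funB.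
  by move=> y _; rewrite lee_fin mulr_ge0.
rewrite (fubini_tonelli (fun p : GR * GR => (W p.1 * (f (p.1 - p.2) * h p.2))%:E))//=; last first.
  by move=> p; rewrite lee_fin !mulr_ge0.
apply: eq_integral => y _.
rewrite -(ge0_integral_shift y (f := fun x => (W x * (f (x - y) * h y))%:E)).
- by apply: eq_integral => z _; rewrite addrK mulrA.
- apply/measurable_EFinP; apply: measurable_funM => //.
  apply: measurable_funM => //.
  by apply: (measurableT_comp mf); exact: measurable_funB.
- by move=> x; rewrite lee_fin !mulr_ge0.
Qed.

End lebesgue_isometries.

(** At a sum the weight satisfies [w (z + y) * e (z + y) <= (w z + w y) * (e z * e y)]. Each of the
    two terms separates the variables and integrates to the product of the two integrals on the
    right, whence the factor 2. *)
Lemma weighted_self_convolution_le {R : realType} (g w e : R -> R) :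
  measurable_fun [set: R] g -> measurable_fun [set: R] w ->
  measurable_fun [set: R] e ->
  (forall x, 0 <= g x) -> (forall x, 0 <= w x) -> (forall x, 0 <= e x) ->
  (forall x y, w (x + y) <= w x + w y) ->
  (forall x y, e (x + y) <= e x * e y) ->
  (\int[lebesgue_measure]_x ((w x * e x)%:E *
     \int[lebesgue_measure]_y (g (x - y) * g y)%:E) <=
   2%:E * (\int[lebesgue_measure]_x (w x * e x * g x)%:E *
           \int[lebesgue_measure]_x (e x * g x)%:E))%E.
Proof.
move=> mg mw me g0 w0 e0 wD eM.
set A := (X in (2%:E * (X * _))%E); set B := (X in (2%:E * (_ * X))%E).
have mEg : measurable_fun [set: R] (fun x => (e x * g x)%:E).
  by apply/measurable_EFinP; exact: measurable_funM.
have mWg : measurable_fun [set: R] (fun x => (w x * e x * g x)%:E).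
  by apply/measurable_EFinP; do ?apply: measurable_funM.
have A0 : (0 <= A)%E by apply: integral_ge0 => x _; rewrite lee_fin !mulr_ge0.
have B0 : (0 <= B)%E by apply: integral_ge0 => x _; rewrite lee_fin !mulr_ge0.
have mw' (y : R) : measurable_fun [set: R] (fun z => w (z + y)).
  by apply: (measurableT_comp mw); exact: measurable_funD.
have me' (y : R) : measurable_fun [set: R] (fun z => e (z + y)).
  by apply: (measurableT_comp me); exact: measurable_funD.
rewrite ge0_integral_convolution//; last 2 first.
- exact: measurable_funM.
- by move=> x; rewrite mulr_ge0.
have inner (y : R) : (\int[lebesgue_measure]_z
    (w (z + y) * e (z + y) * g z * g y)%:E <=
    A * (e y * g y)%:E + B * (w y * e y * g y)%:E)%E.
  rewrite /A /B -!ge0_integralZr ?lee_fin ?mulr_ge0//; last 2 first.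
  - by move=> x _; rewrite lee_fin !mulr_ge0.
  - by move=> x _; rewrite lee_fin !mulr_ge0.
  rewrite -ge0_integralD//; last 4 first.
  - by move=> x _; rewrite -EFinM lee_fin !mulr_ge0.
  - apply: emeasurable_funM => //; exact: measurable_cst.
  - by move=> x _; rewrite -EFinM lee_fin !mulr_ge0.
  - apply: emeasurable_funM => //; exact: measurable_cst.
  apply: ge0_le_integral => //.
  - by move=> x _; rewrite lee_fin !mulr_ge0.
  - apply/measurable_EFinP; do ?apply: measurable_funM => //; [exact: mw'|exact: me'].
  - by apply: emeasurable_funD; apply: emeasurable_funM => //; exact: measurable_cst.
  move=> z _; rewrite -!EFinM -EFinD lee_fin.
  have -> : w z * e z * g z * (e y * g y) + e z * g z * (w y * e y * g y) =
    (w z + w y) * (e z * e y) * g z * g y by ring.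
  by do 2 apply: ler_wpM2r => //; apply: ler_pM.
apply: (@le_trans _ _ (\int[lebesgue_measure]_y
    (A * (e y * g y)%:E + B * (w y * e y * g y)%:E))%E).
  apply: ge0_le_integral => //.
  - by move=> y _; apply: integral_ge0 => z _; rewrite lee_fin !mulr_ge0.
  - pose GR := measurableTypeR R.
    apply: (measurable_fun_fubini_tonelli_G (m1 := @lebesgue_measure R)
      (fun p : GR * GR => (w (p.1 + p.2) * e (p.1 + p.2) * g p.1 * g p.2)%:E)) => /=.
      have mD : measurable_fun [set: GR * GR] (fun p : GR * GR => (p.1 + p.2 : R)).
        exact: measurable_funD.
      apply/measurable_EFinP; do ?apply: measurable_funM => /=.
      - exact: (measurableT_comp mw).
      - exact: (measurableT_comp me).
      - exact: (measurableT_comp mg).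
      - exact: (measurableT_comp mg).
    by move=> p; rewrite lee_fin !mulr_ge0.
  - by apply: emeasurable_funD; apply: emeasurable_funM => //; exact: measurable_cst.
rewrite ge0_integralD//; last 4 first.
- by move=> x _; rewrite mule_ge0// lee_fin !mulr_ge0.
- by apply: emeasurable_funM => //; exact: measurable_cst.
- by move=> x _; rewrite mule_ge0// lee_fin !mulr_ge0.
- by apply: emeasurable_funM => //; exact: measurable_cst.
rewrite !ge0_integralZl//; last 2 first.
- by move=> x _; rewrite lee_fin !mulr_ge0.
- by move=> x _; rewrite lee_fin !mulr_ge0.
by rewrite -/A -/B (muleC B A) -mule2n -muleC mule_natl.
Qed.

(** * Tails of a distribution and the layer-cake formula *)

Section tails.
Context {R : realType} (P : probability R R).
Local Notation mu := (@lebesgue_measure R).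

(* Vanishing on the negative half-line makes [tail_conv] a convolution over all of R. *)
Definition half_tail (x : R) : R := if 0 <= x then tail P x else 0.

Lemma tailE x : (tail P x)%:E = P `]x, +oo[%classic.
Proof. by rewrite /tail fineK// fin_num_measure. Qed.

Lemma tail_ge0 x : 0 <= tail P x.
Proof. by rewrite -lee_fin tailE. Qed.

Lemma tail_le1 x : tail P x <= 1.
Proof. by rewrite -lee_fin tailE probability_le1. Qed.

Lemma tail_nonincreasing : {homo tail P : x y /~ x <= y}.
Proof.
move=> x y xy; rewrite -lee_fin !tailE le_measure ?inE//.
exact: subitvPl.
Qed.

Lemma measurable_tail : measurable_fun [set: R] (tail P).
Proof. by apply: nonincreasing_measurable => // x y; exact: tail_nonincreasing. Qed.

Lemma half_tail_ge0 x : 0 <= half_tail x.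
Proof. by rewrite /half_tail; case: ifP => // _; exact: tail_ge0. Qed.

Lemma half_tail_le1 x : half_tail x <= 1.
Proof. by rewrite /half_tail; case: ifP => // _; exact: tail_le1. Qed.

Lemma half_tail_nonincreasing x y : 0 <= x -> x <= y -> half_tail y <= half_tail x.
Proof.
by move=> x0 xy; rewrite /half_tail x0 (le_trans x0 xy); exact: tail_nonincreasing.
Qed.

Lemma measurable_half_tail : measurable_fun [set: R] half_tail.
Proof.
apply: measurable_fun_ifT => //; last exact: measurable_tail.
exact: measurable_fun_ler.
Qed.

(** Outside [[0, x]] one of the two factors vanishes. On [[0, x]] the integrand is at most 1, so the
    integral is finite and [fine] loses nothing. *)
Lemma tail_convE x :
  (tail_conv P x)%:E = (\int[mu]_y (half_tail (x - y) * half_tail y)%:E)%E.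
Proof.
have mt : measurable_fun [set: R] (fun y => (tail P (x - y) * tail P y)%:E).
  apply/measurable_EFinP; apply: measurable_funM; last exact: measurable_tail.
  by apply: (measurableT_comp measurable_tail); exact: measurable_funB.
have t0 y : (0 <= (tail P (x - y) * tail P y)%:E)%E.
  by rewrite lee_fin mulr_ge0 ?tail_ge0.
rewrite /tail_conv /Rintegral fineK.
  rewrite integral_mkcond; apply: eq_integral => y _.
  rewrite patchE /half_tail subr_ge0 mem_setE in_itv/= andbC.
  by case: (y <= x); case: (0 <= y); rewrite ?(mul0r, mulr0).
rewrite ge0_fin_numE; last exact: integral_ge0.
apply: (@le_lt_trans _ _ (\int[mu]_(y in `[0%R, x]) 1%:E)%E).
  apply: ge0_le_integral => //; first exact: measurable_funTS.
  by move=> y _; rewrite lee_fin mulr_ile1// ?tail_ge0 ?tail_le1.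
rewrite integral_cst//= mul1e lebesgue_measure_itv/=.
by case: ifP => // _; rewrite -EFinB ltry.
Qed.

Let GR := measurableTypeR R.

(** Indicator of the region [0 <= y < x]. As a function on the product space it turns integrals over
    the variable interval [[0, x[] into a form to which Tonelli applies. *)
Let below (p : R * GR) : R := if (0 <= p.2) && (p.2 < p.1) then 1 else 0.

Let measurable_below : measurable_fun [set: R * GR] below.
Proof.
apply: measurable_fun_ifT => //.
by apply: measurable_and; [exact: measurable_fun_ler|exact: measurable_fun_ltr].
Qed.

Let below_ge0 p : 0 <= below p.
Proof. by rewrite /below; case: ifP. Qed.

Let integral_below (phi : R -> R) (x : R) :
  (\int[mu]_(y in `[0%R, x[) (phi y)%:E =
   \int[mu]_y (phi y * below (x, y))%:E)%E.
Proof.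
rewrite integral_mkcond; apply: eq_integral => y _.
rewrite patchE mem_setE in_itv/= /below/=.
by case: ifP; rewrite ?mulr1 ?mulr0.
Qed.

Let measurable_phi_below (phi : R -> R) : measurable_fun [set: R] phi ->
  measurable_fun [set: R * GR] (fun p => (phi p.2 * below p)%:E).
Proof.
move=> mphi; apply/measurable_EFinP; apply: measurable_funM => //.
exact: (measurableT_comp mphi).
Qed.

Lemma measurable_integral_itv0 (phi : R -> R) :
  measurable_fun [set: R] phi -> (forall y, 0 <= phi y) ->
  measurable_fun [set: R] (fun x => \int[mu]_(y in `[0%R, x[) (phi y)%:E)%E.
Proof.
move=> mphi phi0.
under eq_fun do rewrite integral_below.
apply: (measurable_fun_fubini_tonelli_F (m2 := mu)
  (fun p : R * GR => (phi p.2 * below p)%:E)).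
  exact: measurable_phi_below.
by move=> p; rewrite lee_fin mulr_ge0.
Qed.

(** For [y >= 0] the tail at [y] is the [P]-integral of [below (x, y)] in [x]; exchanging the
    integrals gives the layer-cake formula. *)
Lemma tonelli_half_tail (phi : R -> R) :
  measurable_fun [set: R] phi -> (forall y, 0 <= phi y) ->
  (\int[mu]_y (phi y * half_tail y)%:E =
   \int[P]_x \int[mu]_(y in `[0%R, x[) (phi y)%:E)%E.
Proof.
move=> mphi phi0.
under [RHS]eq_integral do rewrite integral_below.
rewrite (fubini_tonelli (fun p : R * GR => (phi p.2 * below p)%:E))/=; last 2 first.
- exact: measurable_phi_below.
- by move=> p; rewrite lee_fin mulr_ge0.
apply: eq_integral => y _.
under [RHS]eq_integral do rewrite EFinM.
rewrite ge0_integralZl ?lee_fin//; last 2 first.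
- apply/measurable_EFinP; exact: (measurableT_comp measurable_below).
- by move=> x _; rewrite lee_fin.
rewrite EFinM; congr (_ * _)%E.
rewrite /half_tail /below; case: ifP => y0 /=; last by rewrite integral0.
rewrite tailE; apply/esym; transitivity (\int[P]_(x in `]y, +oo[) cst 1 x)%E;
  last by rewrite integral_cst// mul1e.
rewrite [RHS]integral_mkcond.
by apply: eq_integral => x _; rewrite patchE mem_setE in_itv/= andbT; case: ifP.
Qed.

(** Layer cake with [phi = 1]: the inner integral is the positive part of [x], which equals [x]
    almost surely by the support condition. *)
Lemma mean_half_tail : supported_nonneg P ->
  mean P = (\int[mu]_y (half_tail y)%:E)%E.
Proof.
move=> P0.
under eq_integral do rewrite -[half_tail _]mul1r.
rewrite (@tonelli_half_tail (fun=> 1))//.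
transitivity (\int[P]_x (Num.max 0 x)%:E)%E; last first.
  apply: eq_integral => x _.
  rewrite integral_cst//= mul1e lebesgue_measure_itv/= lte_fin sube0.
  by case: ltP => // x0; rewrite max_l.
apply: ae_eq_integral => //.
- by apply/measurable_EFinP; exact: measurable_maxr.
- exists `]-oo, (0:R)[%classic; split => //.
    have -> : `]-oo, (0:R)[%classic = ~` `[0, +oo[%classic by rewrite setCitvr.
    transitivity (1 - P `[0%R, +oo[%classic)%E; first exact: probability_setC.
    by rewrite P0 subee.
  move=> x /=; rewrite in_itv/=; apply: contra_notP => /negP; rewrite -leNgt => x0 _.
  by rewrite max_r.
Qed.

End tails.

(** * Uniform bounds carried through truncations by monotone convergence *)

Lemma ge0_integral_le_eventually {d} {T : measurableType d} {R : realType}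
    (mu : {measure set T -> \bar R}) (f : (T -> R)^nat) (g : T -> R) (B : \bar R) :
  (forall n, measurable_fun [set: T] (f n)) ->
  (forall n x, 0 <= f n x) ->
  (forall x, nondecreasing_seq (f ^~ x)) ->
  (forall x, \forall n \near \oo, f n x = g x) ->
  (forall n, (\int[mu]_x (f n x)%:E <= B)%E) ->
  (\int[mu]_x (g x)%:E <= B)%E.
Proof.
move=> mf f0 fnd fg fB.
have -> : (\int[mu]_x (g x)%:E = \int[mu]_x limn (fun n => (f n x)%:E))%E.
  apply: eq_integral => x _; apply/esym/cvg_lim => //.
  apply: cvg_near_cst; near=> n; congr EFin; near: n; exact: fg.
have mfE n : measurable_fun [set: T] (EFin \o f n) by exact/measurable_EFinP.
rewrite monotone_convergence//; last 2 first.
- by move=> n x _; rewrite lee_fin.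
- by move=> x _ m n mn; rewrite lee_fin fnd.
apply: lime_le; last exact: nearW.
apply: ereal_nondecreasing_is_cvgn => m n mn; apply: ge0_le_integral => //.
- by move=> t _; rewrite lee_fin; exact: f0.
- exact: mfE.
- exact: mfE.
- by move=> t _; rewrite lee_fin; exact: fnd.
Unshelve. all: by end_near. Qed.

(** * Truncation, the lower bound on the convolution, and unbounded exponential moments *)

Section half_tail_estimates.
Context {R : realType} (P : probability R R).
Local Notation mu := (@lebesgue_measure R).

(** The truncation t of the overview. The cut at 0 keeps it nonnegative on the whole line, as the
    weighted convolution inequality demands, and preserves subadditivity. *)
Definition clip (N x : R) : R := Num.max 0 (Num.min x N).

Lemma clip_ge0 N x : 0 <= clip N x.
Proof. by rewrite /clip le_max lexx. Qed.

Lemma clip_le N x : 0 <= N -> clip N x <= N.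
Proof. by move=> N0; rewrite /clip ge_max N0 ge_min lexx orbT. Qed.

Lemma clip_id N x : 0 <= x <= N -> clip N x = x.
Proof. by case/andP => x0 xN; rewrite /clip min_l// max_r. Qed.

Lemma clipD N x y : 0 <= N -> clip N (x + y) <= clip N x + clip N y.
Proof.
rewrite /clip !maxEle !minEle => N0.
case: (leP x N) => xN; case: (leP y N) => yN; case: (leP (x + y) N) => xyN;
  do ?case: ifPn; rewrite -?ltNge; lra.
Qed.

Lemma le_clip M N x : M <= N -> clip M x <= clip N x.
Proof.
rewrite /clip !maxEle !minEle => N0.
by do ?case: ifPn; rewrite -?ltNge; lra.
Qed.

Lemma clipS N x : 0 <= N -> clip (N + 1) x <= clip N x + 1.
Proof.
rewrite /clip !maxEle !minEle => N0.
by do ?case: ifPn; rewrite -?ltNge; lra.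
Qed.

Lemma clip0 x : clip 0 x = 0.
Proof.
rewrite /clip !maxEle !minEle.
by do ?case: ifPn; rewrite -?ltNge; lra.
Qed.

Lemma measurable_clip N : measurable_fun [set: R] (clip N).
Proof. by apply: measurable_maxr => //; exact: measurable_minr. Qed.

(** The pieces [y < M] and [x - y < M] are disjoint because [2 * M <= x]. On each, one factor has
    its argument in [[0, x]] and so is at least [tail P x]; the reflection [y -> x - y] shows that
    both pieces contribute equally. *)
Lemma tail_conv_ge (M x : R) : 0 <= M -> 2 * M <= x ->
  (2%:E * (tail P x)%:E * \int[mu]_(y in `[0%R, M[) (half_tail P y)%:E <=
   (tail_conv P x)%:E)%E.
Proof.
move=> M0 Mx.
have x0 : 0 <= x by lra.
pose h (y : R) := half_tail P y * (if (0 <= y) && (y < M) then 1 else 0).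
have h0 y : 0 <= h y by rewrite /h mulr_ge0 ?half_tail_ge0//; case: ifP.
have mt := measurable_half_tail P.
have mh : measurable_fun [set: R] h.
  apply: measurable_funM => //; apply: measurable_fun_ifT => //.
  by apply: measurable_and; [exact: measurable_fun_ler|exact: measurable_fun_ltr].
have mEh : measurable_fun [set: R] (fun y => (h y)%:E) by exact/measurable_EFinP.
have mhx : measurable_fun [set: R] (fun y => h (x - y)).
  by apply: (measurableT_comp mh); exact: measurable_funB.
have -> : (\int[mu]_(y in `[0%R, M[) (half_tail P y)%:E = \int[mu]_y (h y)%:E)%E.
  rewrite integral_mkcond; apply: eq_integral => y _.
  by rewrite patchE mem_setE in_itv/= /h; case: ifP; rewrite ?mulr1 ?mulr0.
rewrite muleAC -muleA; set I := integral _ _ _.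
have I0 : (0 <= I)%E by apply: integral_ge0 => y _; rewrite lee_fin.
have -> : (2%:E * (I * (tail P x)%:E) =
   \int[mu]_y ((tail P x)%:E * ((h y)%:E + (h (x - y))%:E)))%E.
  rewrite ge0_integralZl ?lee_fin ?tail_ge0//; last 2 first.
  - by apply: emeasurable_funD => //; exact/measurable_EFinP.
  - by move=> y _; rewrite -EFinD lee_fin addr_ge0.
  rewrite ge0_integralD//; last 3 first.
  - by move=> y _; rewrite lee_fin.
  - by move=> y _; rewrite lee_fin.
  - exact/measurable_EFinP.
  rewrite (@ge0_integral_reflect _ (fun y => (h y)%:E))// -/I.
  by rewrite (muleC I) muleCA mule_natl mule2n.
rewrite tail_convE; apply: ge0_le_integral => //.
- by move=> y _; rewrite -EFinD -EFinM lee_fin mulr_ge0 ?tail_ge0// addr_ge0.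
- apply: emeasurable_funM => //; apply: emeasurable_funD => //.
  exact/measurable_EFinP.
- apply/measurable_EFinP; apply: measurable_funM => //.
  by apply: (measurableT_comp mt); exact: measurable_funB.
move=> y _; rewrite -EFinD -EFinM lee_fin.
have tx : tail P x = half_tail P x by rewrite /half_tail x0.
have T0 := half_tail_ge0 P.
have [yM|yM] := boolP ((0 <= y) && (y < M)).
  have -> : h (x - y) = 0.
    by rewrite /h ifF ?mulr0//; apply/negbTE/nandP; right; rewrite -leNgt; lra.
  rewrite /h yM addr0 mulr1 tx ler_wpM2r//.
  by apply: half_tail_nonincreasing; lra.
have -> : h y = 0 by rewrite /h (negbTE yM) mulr0.
rewrite add0r /h; case: ifPn => [xyM|_]; last by rewrite !mulr0 mulr_ge0.
rewrite mulr1 mulrC ler_wpM2l// tx.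
by apply: half_tail_nonincreasing; lra.
Qed.

(** A bound uniform in [n] would pass to the untruncated exponential. By layer cake, [J x], the
    integral of [e] over [[0, x[], would then have finite expectation; as [e x <= e 1 + e 1 * J x],
    so would [e], against heavy-tailedness. *)
Lemma exp_clip_half_tail_unbounded (gamma B : R) : heavy_tailed P -> 0 < gamma ->
  exists n : nat,
    (B%:E < \int[mu]_y (expR (gamma * clip n%:R y) * half_tail P y)%:E)%E.
Proof.
move=> heavy gamma0; apply/not_existsP => bounded.
pose e (y : R) := expR (gamma * y).
have me : measurable_fun [set: R] e.
  by apply: measurableT_comp => //; exact: measurable_funM.
have e0 y : 0 <= e y by exact: expR_ge0.
have : (\int[mu]_y (e y * half_tail P y)%:E <= B%:E)%E.
  apply: (@ge0_integral_le_eventually _ _ _ mu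
    (fun n y => expR (gamma * clip n%:R y) * half_tail P y)).
  - move=> n; apply: measurable_funM; last exact: measurable_half_tail.
    apply: measurableT_comp => //; apply: measurable_funM => //.
    exact: measurable_clip.
  - by move=> n x; rewrite mulr_ge0 ?expR_ge0 ?half_tail_ge0.
  - move=> x m n mn; rewrite ler_wpM2r ?half_tail_ge0// ler_expR ler_wpM2l ?(ltW gamma0)//.
    by apply: le_clip; rewrite ler_nat.
  - move=> x; have [x0|x0] := leP 0 x; last first.
      by apply: nearW => n; rewrite /half_tail leNgt x0/= !mulr0.
    near=> n; rewrite clip_id// x0/=.
    by near: n; exact: nbhs_infty_ger.
  - by move=> n; rewrite leNgt; apply/negP/bounded.
rewrite tonelli_half_tail// => eB.
suff : (\int[P]_x (e x)%:E < +oo)%E by rewrite heavy ?ltxx.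
pose J (x : R) := (\int[mu]_(y in `[0%R, x[) (e y)%:E)%E.
have mJ : measurable_fun [set: R] J by exact: measurable_integral_itv0.
have J0 x : (0 <= J x)%E by apply: integral_ge0 => y _; rewrite lee_fin.
apply: (@le_lt_trans _ _ (\int[P]_x ((e 1)%:E + (e 1)%:E * J x))%E).
  apply: ge0_le_integral => //.
  - by move=> x _; rewrite lee_fin.
  - exact/measurable_EFinP.
  - by apply: emeasurable_funD => //; exact: measurable_funeM.
  move=> x _; have [x1|x1] := leP x 1.
    apply: (@le_trans _ _ (e 1)%:E); last by rewrite leeDl// mule_ge0// lee_fin.
    by rewrite lee_fin ler_expR ler_wpM2l// ltW.
  apply: (@le_trans _ _ ((e 1)%:E * (e (x - 1))%:E)%E).
    by rewrite -EFinM lee_fin /e -expRD -mulrDr addrC subrK.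
  apply: (@le_trans _ _ ((e 1)%:E * J x)%E); last by rewrite leeDr// lee_fin.
  apply: lee_wpmul2l; first by rewrite lee_fin.
  (* On the unit interval [[x - 1, x[] the increasing function [e] is at least [e (x - 1)]; since
     [x > 1], this interval lies inside [[0, x[]. *)
  apply: (@le_trans _ _ (\int[mu]_(y in `[(x - 1)%R, x[) (e (x - 1))%:E)%E).
    rewrite integral_cst//= lebesgue_measure_itv/= lte_fin ifT; last by lra.
    by rewrite -EFinB opprB subrKC mule1.
  apply: (@le_trans _ _ (\int[mu]_(y in `[(x - 1)%R, x[) (e y)%:E)%E).
    apply: ge0_le_integral => //.
    - by move=> y _; rewrite lee_fin.
    - by apply/measurable_EFinP; exact: measurable_funTS.
    move=> y /=; rewrite in_itv/= => /andP[xy _].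
    by rewrite lee_fin ler_expR ler_wpM2l// ltW.
  apply: ge0_subset_integral => //.
  - by apply/measurable_EFinP; exact: measurable_funTS.
  - by move=> y _; rewrite lee_fin.
  by move=> y /=; rewrite !in_itv/= => /andP[xy ->]; rewrite andbT; lra.
rewrite ge0_integralD//; last 3 first.
- by move=> x _; rewrite lee_fin.
- by move=> x _; rewrite mule_ge0// lee_fin.
- exact: measurable_funeM.
rewrite ge0_integralZl ?lee_fin//.
rewrite lte_add_pinfty//.
  by rewrite integral_cst//= probability_setT mule1 ltry.
apply: lte_mul_pinfty => //; first by rewrite lee_fin.
by rewrite (le_lt_trans eB)// ltry.
Unshelve. all: by end_near. Qed.

End half_tail_estimates.

(** * The limit of the ratio compared with twice the integral of the tail *)

Section tail_convolution_ratio.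
Context {R : realType} (P : probability R R).
Local Notation mu := (@lebesgue_measure R).

Lemma measurable_tail_conv : measurable_fun [set: R] (tail_conv P).
Proof.
apply/measurable_EFinP.
have -> : EFin \o tail_conv P =
    (fun x => \int[mu]_y (half_tail P (x - y) * half_tail P y)%:E)%E.
  by apply/funext => x /=; rewrite tail_convE.
pose GR := measurableTypeR R.
apply: (measurable_fun_fubini_tonelli_F (m2 := mu)
  (fun p : GR * GR => (half_tail P (p.1 - p.2) * half_tail P p.2)%:E)).
  apply/measurable_EFinP; apply: measurable_funM.
    apply: (measurableT_comp (measurable_half_tail P)).
    exact: measurable_funB.
  exact: (measurableT_comp (measurable_half_tail P)).
by move=> p; rewrite lee_fin mulr_ge0 ?half_tail_ge0.
Qed.

Lemma tail_conv_ge0 x : 0 <= tail_conv P x.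
Proof.
rewrite -lee_fin tail_convE; apply: integral_ge0 => y _.
by rewrite lee_fin mulr_ge0 ?half_tail_ge0.
Qed.

(** For each [n], [tail_conv_ge] with [M = n] bounds the ratio below, for all large [x], by twice
    the integral over [[0, n[]. Let first [x] and then [n] tend to infinity. *)
Lemma double_half_tail_integral_le_limit (c : R) : (forall x, 0 < tail P x) ->
  (tail_conv P x / tail P x @[x --> +oo] --> c) ->
  (\int[mu]_y (half_tail P y)%:E <= (c / 2)%:E)%E.
Proof.
move=> tail_gt0 cvgc.
have mt := measurable_half_tail P.
apply: (@ge0_integral_le_eventually _ _ _ mu (fun (n : nat) y =>
    if (0 <= y) && (y < n%:R) then half_tail P y else 0)).
- move=> n; apply: measurable_fun_ifT => //.
  by apply: measurable_and; [exact: measurable_fun_ler|exact: measurable_fun_ltr].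
- by move=> n x; case: ifP => // _; exact: half_tail_ge0.
- move=> x m n mn; case: (leP 0 x) => x0 //=.
  case: ifPn => xm; last by case: ifP => // _; exact: half_tail_ge0.
  by rewrite ifT// (lt_le_trans xm)// ler_nat.
- move=> x; have [x0|x0] /= := leP 0 x; last first.
    by apply: nearW => n; rewrite /half_tail leNgt x0.
  near=> n; rewrite ifT//.
  by near: n; exact: nbhs_infty_gtr.
move=> n.
rewrite (_ : integral _ _ _ =
  \int[mu]_(y in `[0%R, n%:R[) (half_tail P y)%:E)%E; last first.
  rewrite [RHS]integral_mkcond; apply: eq_integral => y _.
  by rewrite patchE mem_setE in_itv/=; case: ifP.
set I := integral _ _ _.
have I0 : (0 <= I)%E.
  by apply: integral_ge0 => y _; rewrite lee_fin half_tail_ge0.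
have IE x : 2 * n%:R <= x -> (2%:E * (tail P x)%:E * I <= (tail_conv P x)%:E)%E.
  by move=> nx; exact: tail_conv_ge.
(* An infinite integral is excluded by the inequality at [x = 2 * n], where the tail is positive and
   the convolution is a real number. *)
move: I I0 IE => [i| |//] i0 IE; last first.
  have := IE _ (lexx _).
  by rewrite gt0_muley// mule_gt0// lte_fin.
rewrite lee_fin ler_pdivlMr// mulrC.
rewrite -(cvg_lim _ cvgc)//; apply: limr_ge; first by apply/cvg_ex; exists c.
near=> x; rewrite ler_pdivlMr// mulrAC -lee_fin !EFinM; apply: IE.
by near: x; apply: nbhs_pinfty_ge; rewrite num_real.
Unshelve. all: by end_near. Qed.

(** * Exponentially tilted integrals of the tail *)

Section exponential_tilting.
Variables (a delta x0 gamma N : R).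
Hypotheses (aE : (\int[mu]_y (half_tail P y)%:E = a%:E)%E).
Hypotheses (delta0 : 0 < delta) (x00 : 0 <= x0).
Hypothesis conv_ge : forall x, x0 <= x ->
  (2 * a + delta) * half_tail P x <= tail_conv P x.
Hypotheses (gamma0 : 0 < gamma) (gamma1 : gamma <= 1) (N0 : 0 <= N).

Let e (y : R) := expR (gamma * clip N y).

Let me : measurable_fun [set: R] e.
Proof.
apply: measurableT_comp => //; apply: measurable_funM => //.
exact: measurable_clip.
Qed.

Let a0 : 0 <= a.
Proof.
by rewrite -lee_fin -aE; apply: integral_ge0 => y _; rewrite lee_fin half_tail_ge0.
Qed.

(** The weight is bounded by [N * expR (gamma * N)] and the tail is integrable. *)
Lemma tilted_moment_fin_num :
  (\int[mu]_y (clip N y * e y * half_tail P y)%:E \is a fin_num)%E.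
Proof.
rewrite ge0_fin_numE; last first.
  by apply: integral_ge0 => y _; rewrite lee_fin !mulr_ge0 ?clip_ge0 ?expR_ge0 ?half_tail_ge0.
apply: (@le_lt_trans _ _ (\int[mu]_y ((N * expR (gamma * N))%:E * (half_tail P y)%:E))%E).
  apply: ge0_le_integral => //.
  - by move=> y _; rewrite lee_fin !mulr_ge0 ?clip_ge0 ?expR_ge0 ?half_tail_ge0.
  - apply/measurable_EFinP; do ?apply: measurable_funM => //; first exact: measurable_clip.
    exact: measurable_half_tail.
  - apply: measurable_funeM; apply/measurable_EFinP; exact: measurable_half_tail.
  move=> y _; rewrite -EFinM lee_fin ler_wpM2r ?half_tail_ge0//.
  by rewrite ler_pM ?clip_ge0 ?expR_ge0 ?clip_le// ler_expR ler_wpM2l ?clip_le// ltW.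
rewrite ge0_integralZl ?lee_fin//; last 3 first.
- by apply/measurable_EFinP; exact: measurable_half_tail.
- by move=> y _; rewrite lee_fin half_tail_ge0.
- by rewrite mulr_ge0// expR_ge0.
by rewrite aE -EFinM ltry.
Qed.

(** The convolution integrated against [clip N * e] is at most [2 * (K * p)], and [conv_ge] bounds
    it below beyond [x0]. The last term pays for [[0, x0)]; it depends on neither [gamma] nor [N],
    which makes the later bound on [K] uniform. *)
Lemma tilted_moment_le (K p : R) :
  (\int[mu]_y (e y * half_tail P y)%:E = p%:E)%E ->
  (\int[mu]_y (clip N y * e y * half_tail P y)%:E = K%:E)%E ->
  (2 * a + delta) * K <=
    2 * (K * p) + (2 * a + delta) * x0 * expR x0 * x0.
Proof.
move=> pE KE.
have ht0 := half_tail_ge0 P.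
have mt := measurable_half_tail P.
pose s := 2 * a + delta; rewrite -/s.
have s0 : 0 <= s by rewrite addr_ge0 ?(ltW delta0)// mulr_ge0// a0.
have e0 y : 0 <= e y by exact: expR_ge0.
have := @weighted_self_convolution_le R (half_tail P) (clip N) e
  mt (measurable_clip N) me ht0 (clip_ge0 N) e0 (fun x y => clipD x y N0).
rewrite pE KE => /(_ _)/wrap[].
  move=> x y; rewrite /e -expRD ler_expR -mulrDr ler_wpM2l ?(ltW gamma0)//.
  exact: clipD.
rewrite -!EFinM => conv_le.
rewrite -lee_fin EFinD.
(* Bounds [s] times the weighted tail on [[0, x0)]: there [clip N x <= x0], [e x <= expR x0] because
   [gamma <= 1], and the tail is at most 1. *)
pose C := s * x0 * expR x0.
have C0 : 0 <= C by rewrite /C !mulr_ge0 ?expR_ge0.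
have -> : (s * x0 * expR x0 * x0)%:E =
    (\int[mu]_x (if (0 <= x)%R && (x < x0)%R then C else 0)%:E)%E.
  transitivity (\int[mu]_(x in `[0%R, x0[) cst C%:E x)%E.
    rewrite integral_cst//= lebesgue_measure_itv/= lte_fin sube0.
    by case: ltgtP x00 => // <-; rewrite mulr0 mule0.
  rewrite integral_mkcond; apply: eq_integral => x _.
  by rewrite patchE mem_setE in_itv/=; case: ifP.
apply: le_trans; last first.
  by apply: leeD2r; exact: conv_le.
under eq_integral do rewrite -tail_convE -EFinM.
have mconv := measurable_tail_conv.
have mcl := @measurable_clip R N.
have mI : measurable_fun [set: R] (fun x : R => if (0 <= x)%R && (x < x0)%R then C else 0).
  apply: measurable_fun_ifT => //.
  by apply: measurable_and; [exact: measurable_fun_ler|exact: measurable_fun_ltr].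
have mw : measurable_fun [set: R] (fun x => clip N x * e x * tail_conv P x).
  by do ?apply: measurable_funM.
have mK : measurable_fun [set: R] (fun x => clip N x * e x * half_tail P x).
  by do ?apply: measurable_funM.
have w0 x : 0 <= clip N x * e x by rewrite mulr_ge0 ?clip_ge0.
rewrite -ge0_integralD//; last 4 first.
- by move=> x _; rewrite lee_fin mulr_ge0 ?tail_conv_ge0.
- exact/measurable_EFinP.
- by move=> x _; rewrite lee_fin; case: ifP.
- exact/measurable_EFinP.
rewrite EFinM -KE -ge0_integralZl ?lee_fin//; last 2 first.
- exact/measurable_EFinP.
- by move=> x _; rewrite lee_fin mulr_ge0.
apply: ge0_le_integral => //.
- by move=> x _; rewrite -EFinM lee_fin !mulr_ge0 ?clip_ge0.
- by apply: measurable_funeM; exact/measurable_EFinP.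
- by apply: emeasurable_funD; exact/measurable_EFinP.
move=> x _; rewrite -EFinM -EFinD lee_fin.
have [xx0|xx0] := leP x0 x.
  rewrite andbF addr0 mulrCA ler_wpM2l//.
  exact: conv_ge.
rewrite andbT; case: ifPn => [xge0|]; last first.
  by rewrite /half_tail => /negbTE ->; rewrite !mulr0 addr0 mulr_ge0 ?tail_conv_ge0.
apply: ler_wpDl; first by rewrite mulr_ge0 ?tail_conv_ge0.
have clipx : clip N x <= x0.
  by rewrite /clip ge_max x00 ge_min (ltW xx0).
rewrite /C -!mulrA ler_wpM2l// -[leRHS]mulr1 !mulrA.
rewrite ler_pM ?half_tail_le1// ler_pM ?clip_ge0// ler_expR.
by rewrite (le_trans _ clipx)// ler_piMl ?clip_ge0.
Qed.

(** Integrates the pointwise bound [expR t <= 1 + t * expR t], for [t = gamma * clip N y], against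
    the tail. *)
Lemma tilted_mass_le (K p : R) :
  (\int[mu]_y (e y * half_tail P y)%:E = p%:E)%E ->
  (\int[mu]_y (clip N y * e y * half_tail P y)%:E = K%:E)%E ->
  p <= a + gamma * K.
Proof.
move=> pE KE.
have ht0 := half_tail_ge0 P.
have mt := measurable_half_tail P.
have mcl := @measurable_clip R N.
have e0 y : 0 <= e y by exact: expR_ge0.
have mK : measurable_fun [set: R] (fun x => clip N x * e x * half_tail P x).
  by do ?apply: measurable_funM.
have w0 x : 0 <= clip N x * e x by rewrite mulr_ge0 ?clip_ge0.
rewrite -lee_fin EFinD EFinM -pE -KE -aE -ge0_integralZl ?lee_fin ?(ltW gamma0)//; last 2 first.
- exact/measurable_EFinP.
- by move=> x _; rewrite lee_fin mulr_ge0.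
rewrite -ge0_integralD//; last 4 first.
- by move=> x _; rewrite lee_fin.
- exact/measurable_EFinP.
- by move=> x _; rewrite -EFinM lee_fin !mulr_ge0 ?clip_ge0// ltW.
- by apply: measurable_funeM; exact/measurable_EFinP.
apply: ge0_le_integral => //.
- by move=> x _; rewrite lee_fin mulr_ge0.
- by apply/measurable_EFinP; exact: measurable_funM.
- apply: emeasurable_funD; first exact/measurable_EFinP.
  by apply: measurable_funeM; exact/measurable_EFinP.
move=> x _; rewrite -EFinM -EFinD lee_fin.
rewrite mulrA -[X in X + _]mul1r -mulrDl ler_wpM2r// mulrA.
set t := gamma * clip N x.
(* [1 - t <= expR (- t)], multiplied by [expR t] *)
have : (1 - t) * expR t <= 1.
  by rewrite -ler_pdivlMr ?expR_gt0// mul1r -expRN expR_ge1Dx.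
by rewrite /e -/t mulrBl mul1r; lra.
Qed.

End exponential_tilting.

(** * The contradiction from a limit exceeding twice the mean *)

Lemma limit_le_double_half_tail_integral (a c : R) : heavy_tailed P ->
  (forall x, 0 < tail P x) ->
  (\int[mu]_y (half_tail P y)%:E = a%:E)%E ->
  (tail_conv P x / tail P x @[x --> +oo] --> c) ->
  c <= 2 * a.
Proof.
move=> heavy tail_gt0 aE cvgc; rewrite leNgt; apply/negP => ac.
have a0 : 0 <= a.
  by rewrite -lee_fin -aE; apply: integral_ge0 => y _; rewrite lee_fin half_tail_ge0.
(* Half the gap, so that [2 * a + delta] is still strictly below [c] and the ratio eventually
   exceeds it. *)
pose delta := (c - 2 * a) / 2.
have delta0 : 0 < delta by rewrite /delta; lra.
have [x0 [x00 conv_ge]] : exists x0, 0 <= x0 /\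
    forall x, x0 <= x -> (2 * a + delta) * half_tail P x <= tail_conv P x.
  have : \forall x \near +oo, 2 * a + delta <= tail_conv P x / tail P x.
    apply: (cvgr_ge c cvgc); rewrite /delta; lra.
  (* The neighbourhood of infinity is the open ray beyond [x1]; adding 1 allows the non-strict
     [x0 <= x]. *)
  move=> [x1 [_ x1P]]; exists (Num.max 0 (x1 + 1)); split.
    by rewrite le_max lexx.
  move=> x; rewrite ge_max => /andP[x_ge0 x1x].
  by rewrite /half_tail x_ge0 -ler_pdivlMr//; apply: x1P; lra.
pose B := (2 * a + delta) * x0 * expR x0 * x0.
have B0 : 0 <= B by rewrite /B !mulr_ge0 ?expR_ge0//; lra.
(* The first bound serves [tilted_moment_le]; the second makes a unit increase of the truncation
   level cost at most [delta / 8]; the third yields the final contradiction. The [+ 1] keeps the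
   divisor positive and makes [gamma * B] strictly less than [delta ^+ 2 / 16]. *)
pose gamma := Num.min 1 (Num.min (delta / 8 / (a + delta / 4))
                                 (delta ^+ 2 / 16 / (B + 1))).
have gamma0 : 0 < gamma.
  by rewrite /gamma !lt_min ltr01 !divr_gt0// ?exprn_gt0//; lra.
have gamma1 : gamma <= 1 by rewrite /gamma ge_min lexx.
have gamma2 : gamma * (a + delta / 4) <= delta / 8.
  by rewrite -ler_pdivlMr; [rewrite /gamma !ge_min lexx orbT|lra].
have gamma3 : gamma * (B + 1) <= delta ^+ 2 / 16.
  by rewrite -ler_pdivlMr; [rewrite /gamma !ge_min lexx !orbT|lra].
pose phi (n : nat) :=
  (\int[mu]_y (expR (gamma * clip n%:R y) * half_tail P y)%:E)%E.
(* The least level whose tilted mass exceeds [a + delta / 4]. It is not 0, since [phi 0] is [a]; its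
   predecessor is the truncation level used below. *)
have [n phin nmin] : {n | ((a + delta / 4)%:E < phi n)%E &
    forall m, ((a + delta / 4)%:E < phi m)%E -> (n <= m)%N}.
  have ex := exp_clip_half_tail_unbounded (a + delta / 4) heavy gamma0.
  by case: (ex_minnP ex) => n; exists n.
case: n => [|n] in phin nmin.
  move: phin; rewrite /phi.
  under eq_integral do rewrite clip0 mulr0 expR0 mul1r.
  by rewrite aE lte_fin; lra.
have phi_le : (phi n <= (a + delta / 4)%:E)%E.
  by rewrite leNgt; apply/negP => /nmin; rewrite ltnn.
have phi0 : (0 <= phi n)%E.
  by apply: integral_ge0 => y _; rewrite lee_fin mulr_ge0 ?expR_ge0 ?half_tail_ge0.
have mphi m : measurable_fun [set: R]
    (fun y => (expR (gamma * clip m%:R y) * half_tail P y)%:E).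
  apply/measurable_EFinP; apply: measurable_funM; last exact: measurable_half_tail.
  by apply: measurableT_comp => //; apply: measurable_funM => //; exact: measurable_clip.
(* Raising the level by one raises [clip] by at most 1, so the mass before the crossing cannot be
   far below the threshold. *)
have phiS : (phi n.+1 <= (expR gamma)%:E * phi n)%E.
  rewrite /phi -ge0_integralZl ?lee_fin ?expR_ge0//; last 2 first.
  - exact: mphi.
  - by move=> y _; rewrite lee_fin mulr_ge0 ?expR_ge0 ?half_tail_ge0.
  apply: ge0_le_integral => //.
  - by move=> y _; rewrite lee_fin mulr_ge0 ?expR_ge0 ?half_tail_ge0.
  - exact: mphi.
  - by apply: measurable_funeM; exact: mphi.
  move=> y _; rewrite -EFinM lee_fin mulrA ler_wpM2r ?half_tail_ge0//.
  rewrite -expRD ler_expR -[X in X + _]mulr1 -mulrDr ler_wpM2l ?(ltW gamma0)//.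
  by rewrite addrC -natr1 clipS.
have phi_fin : phi n \is a fin_num by rewrite ge0_fin_numE// (le_lt_trans phi_le)// ltry.
have := @tilted_moment_fin_num a gamma n%:R aE gamma0 (ler0n _ _).
set KE := integral _ _ _ => K_fin.
have pE : phi n = (fine (phi n))%:E by rewrite fineK.
have K_E : KE = (fine KE)%:E by rewrite fineK.
have := tilted_moment_le aE delta0 x00 conv_ge gamma0 gamma1 (ler0n _ n) pE K_E.
have := tilted_mass_le aE gamma0 pE K_E.
move: phi_le phi0 (lt_le_trans phin phiS); rewrite pE -EFinM !lee_fin lte_fin.
have : 0 <= fine KE.
  apply/fine_ge0/integral_ge0 => y _.
  by rewrite lee_fin !mulr_ge0 ?clip_ge0 ?expR_ge0 ?half_tail_ge0.
move: (fine KE) (fine (phi n)) => K p K0 p_le p0 p_gt p_leK; rewrite -/B /= in p_leK * => KB.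
clear -delta0 a0 B0 gamma0 gamma1 gamma2 gamma3 K0 p0 p_le p_gt p_leK KB.
clearbody B gamma delta.
(* From [a + delta / 4 < expR gamma * p] and [(1 - gamma) * expR gamma <= 1]; the loss
   [gamma * (a + delta / 4)] is at most [delta / 8]. *)
have p_ge : a + delta / 8 <= p.
  have eg : (1 - gamma) * expR gamma <= 1.
    by rewrite -ler_pdivlMr ?expR_gt0// mul1r -expRN expR_ge1Dx.
  have : (1 - gamma) * (a + delta / 4) <= p.
    apply: (@le_trans _ _ ((1 - gamma) * expR gamma * p)).
      by rewrite -mulrA ler_wpM2l ?subr_ge0// ltW.
    by rewrite ler_piMl.
  by rewrite mulrBl mul1r; lra.
have Kge : delta / 8 <= gamma * K by lra.
(* Inserting [p <= a + delta / 4] into the moment inequality cancels [2 * a * K] and leaves half of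
   [delta * K]. *)
have KB' : K * (delta / 2) <= B.
  have : K * p <= K * (a + delta / 4) by rewrite ler_wpM2l.
  lra.
(* Together with [Kge] this gives [delta ^+ 2 / 16 <= gamma * B], whereas [gamma3] gives
   [gamma * B <= delta ^+ 2 / 16 - gamma]. *)
have : gamma * (K * (delta / 2)) <= gamma * B by rewrite ler_wpM2l// ltW.
have : delta / 8 * (delta / 2) <= gamma * K * (delta / 2).
  by rewrite ler_wpM2r//; lra.
rewrite expr2 in gamma3; lra.
Qed.

End tail_convolution_ratio.

Theorem theorem5 (R : realType) (P : probability R R) :
  supported_nonneg P ->
  (forall x : R, 0 < tail P x) ->
  heavy_tailed P ->
  forall c : R, 0 < c ->
  (tail_conv P x / tail P x @[x --> +oo] --> c) ->
  (mean P < +oo)%E /\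
  (tail_conv P x / tail P x @[x --> +oo] --> 2 * fine (mean P)).
Proof.
move=> P0 tail_gt0 heavy c c0 cvgc.
(* This half of the equality comes first: it makes the mean finite, so that [fine] returns its true
   value and the opposite inequality can be applied with a real [a]. *)
have mean_le := double_half_tail_integral_le_limit tail_gt0 cvgc.
rewrite -mean_half_tail// in mean_le.
have mean_lty : (mean P < +oo)%E by rewrite (le_lt_trans mean_le)// ltry.
have meanE : mean P = (fine (mean P))%:E.
  rewrite fineK// ge0_fin_numE// mean_half_tail//.
  by apply: integral_ge0 => y _; rewrite lee_fin half_tail_ge0.
split => //; suff <- : c = 2 * fine (mean P) by [].
apply/eqP; rewrite eq_le; apply/andP; split.
  by apply: limit_le_double_half_tail_integral cvgc => //; rewrite -mean_half_tail.
by move: mean_le; rewrite {1}meanE lee_fin ler_pdivlMr// mulrC.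
Qed.
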